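(* Let $n \ge 1$ be an integer, let $t \in \{0,1,\ldots,2^n-1\}$, and let $k$ (with $0 \le k \le n$) be the number of $1$s in the $n$-bit binary representation of $t$. Let $O$ be the oracle marking the target state $|t\rangle_n$, i.e. $O|t\rangle_n = -|t\rangle_n$ and $O|i\rangle_n = |i\rangle_n$ for every $i \neq t$. Let $0 \le \omega \le \pi$ and let $j \ge 0$ be an integer. Put $$\theta(\omega) = \arcsin\left(\sin^{k}\frac{\omega}{2}\,\cos^{n-k}\frac{\omega}{2}\right).$$ Then, for each of the following two versions of the modified amplitude amplification procedure with $j$ Grover iterations, the amplitude of the target state (the coefficient of $|t\rangle_n$) in the final state equals $$\sin\big((2j+1)\,\theta(\omega)\big).$$ (1) (Starting with a uniform superposition.) The final state is $B(\omega)\,G(\omega)^j\,H^{\otimes n}|0\rangle_n$, where $$B(\omega) = R_Y^{\otimes n}(\omega)\,H^{\otimes n},\qquad G(\omega) = -H^{\otimes n} D H^{\otimes n} B^{\dagger}(\omega)\, O\, B(\omega).$$ (2) (Starting with a binomial superposition.) The final state is $G(\omega)^j\, R_Y^{\otimes n}(\omega)|0\rangle_n$, where $$G(\omega) = -R_Y^{\otimes n}(\omega)\, D\, R_Y^{\otimes n}(-\omega)\, O.$$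
   Context: The state space of an $n$-qubit system is $(\mathbb{C}^2)^{\otimes n} \cong \mathbb{C}^{2^n}$, with orthonormal computational basis $|i\rangle_n$, $i \in \{0,1,\ldots,2^n-1\}$, where $|i\rangle_n$ is the tensor product of the single-qubit basis states $|0\rangle, |1\rangle$ given by the $n$-bit binary representation of $i$. For an operator $U$ on $\mathbb{C}^2$, $U^{\otimes n}$ is its $n$-fold tensor power, and $R_Y^{\otimes n}(\omega)$ means $(R_Y(\omega))^{\otimes n}$. The single-qubit gates are $$H = \frac{1}{\sqrt{2}}\begin{pmatrix} 1 & 1\\ 1 & -1\end{pmatrix},\qquad R_Y(\omega) = \begin{pmatrix} \cos\frac{\omega}{2} & -\sin\frac{\omega}{2}\\ \sin\frac{\omega}{2} & \cos\frac{\omega}{2}\end{pmatrix}.$$ The diffusion operator $D$ is the linear operator that multiplies the amplitude of $|0\rangle_n$ by $-1$ and fixes all other basis states: $D|0\rangle_n = -|0\rangle_n$ and $D|i\rangle_n = |i\rangle_n$ for $i \ne 0$. The dagger denotes the adjoint. The amplitude of a basis state in a state vector is its coefficient in the computational basis. The convention $x^0 = 1$ is used for all real $x$, including $x=0$. *)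

(* Defs.v *)
From mathcomp Require Import all_boot all_order all_algebra.
From mathcomp Require Import all_classical all_reals all_analysis.
From mathcomp Require Export complex.
(* The notation [A ^t k] of mxtens clashes with the one of sesquilinear. *)
From mathcomp Require Export -(notations) mxtens.

Set Implicit Arguments.
Unset Strict Implicit.
Unset Printing Implicit Defensive.

Import Order.TTheory GRing.Theory Num.Theory.
Local Open Scope ring_scope.
Local Open Scope complex_scope.
Local Open Scope sesquilinear_scope.

(* The coefficient of 2 ^ m in the binary expansion of i. *)
Definition bit (i m : nat) : bool := odd (i %/ 2 ^ m).

Definition hamming_weight (n i : nat) : nat := (\sum_(m < n) bit i m)%N.

Section Qubits.
Variable R : realType.
Local Notation C := R[i].

Definition adjoint (m n : nat) (A : 'M[C]_(m, n)) : 'M[C]_(n, m) := A ^t*.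

Definition qubit (b : bool) : 'cV[C]_2 := \col_r (r == b :> nat)%:R.

(* Most significant bit first; the definition is split as [ntensmx] is,
   because 2 ^ n.+1 and 2 * 2 ^ n are convertible only for n > 0. *)
Fixpoint ket_rec (k i : nat) : 'cV[C]_(2 ^ k.+1) :=
  if k is k'.+1 return 'cV[C]_(2 ^ k.+1)
  then tensmx (qubit (bit i k)) (ket_rec k' i)
  else qubit (bit i 0).

Definition ket (n i : nat) : 'cV[C]_(2 ^ n) :=
  if n is k.+1 return 'cV[C]_(2 ^ n) then ket_rec k i else 1.

(* The coefficient of [ket n i] in psi: see [ketE] and [amplitudeE] below. *)
Definition amplitude (n : nat) (i : 'I_(2 ^ n)) (psi : 'cV[C]_(2 ^ n)) : C :=
  psi i 0.

(* U is the (unique, see [flips_uniq]) operator that multiplies the amplitude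
   of [ket n s] by -1 and fixes all other basis states. *)
Definition flips (n s : nat) (U : 'M[C]_(2 ^ n)) : Prop :=
  U *m ket n s = - ket n s /\
  forall i : 'I_(2 ^ n), i != s :> nat -> U *m ket n i = ket n i.
Arguments flips : clear implicits.

Definition mx2 (a b c d : C) : 'M[C]_2 :=
  \matrix_(i, j) if i == 0 then (if j == 0 then a else b)
                 else (if j == 0 then c else d).

Definition hadamard : 'M[C]_2 := (Num.sqrt (2 : R))^-1%:C *: mx2 1 1 1 (-1).

Definition RY (w : R) : 'M[C]_2 :=
  mx2 (cos (w / 2))%:C (- sin (w / 2))%:C
      (sin (w / 2))%:C (cos (w / 2))%:C.

Definition Hn (n : nat) : 'M[C]_(2 ^ n) := ntensmx hadamard n.

Definition RYn (n : nat) (w : R) : 'M[C]_(2 ^ n) := ntensmx (RY w) n.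

Definition B_uniform (n : nat) (w : R) : 'M[C]_(2 ^ n) := RYn n w *m Hn n.

Definition G_uniform (n : nat) (D O : 'M[C]_(2 ^ n)) (w : R) : 'M[C]_(2 ^ n) :=
  - (Hn n *m D *m Hn n *m adjoint (B_uniform n w) *m O *m B_uniform n w).

Definition G_binomial (n : nat) (D O : 'M[C]_(2 ^ n)) (w : R) :
  'M[C]_(2 ^ n) := - (RYn n w *m D *m RYn n (- w) *m O).

Definition theta (n k : nat) (w : R) : R :=
  asin (sin (w / 2) ^+ k * cos (w / 2) ^+ (n - k)).

Lemma adjointE (m n : nat) (A : 'M[C]_(m, n)) i j :
  adjoint A i j = (A j i)^*%C.
Proof. by rewrite /adjoint !mxE. Qed.

Lemma bit_lt2 i : (i < 2)%N -> bit i 0 = i :> nat.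
Proof. by rewrite /bit expn0 divn1; case: i => [|[|]]. Qed.

Lemma bit_mod i k m : (m < k)%N -> bit (i %% 2 ^ k) m = bit i m.
Proof.
move=> mk; rewrite /bit {2}(divn_eq i (2 ^ k)).
have -> : (2 ^ k = 2 ^ (k - m) * 2 ^ m)%N by rewrite -expnD subnK // ltnW.
rewrite mulnA divnMDl ?expn_gt0 // oddD oddM oddX subn_eq0 leqNgt mk.
by rewrite andbF.
Qed.

Lemma ket_rec_mod k l i : (k < l)%N -> ket_rec k (i %% 2 ^ l) = ket_rec k i.
Proof.
elim: k l => [|k IH] l kl /=; first by rewrite bit_mod.
by rewrite bit_mod // IH // ltnW.
Qed.

Lemma ketE (n : nat) (i : 'I_(2 ^ n)) : ket n i = delta_mx i 0.
Proof.
case: n i => [|k] i.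
  apply/matrixP => a b.
  by rewrite (ord1 (a : 'I_1)) (ord1 (i : 'I_1)) [b]ord1 !mxE !eqxx.
rewrite /ket; elim: k i => [|k IH] i.
  apply/matrixP => a b; rewrite !mxE (ord1 b) eqxx andbT.
  by rewrite bit_lt2.
case: (@mxtens_indexP 2 (2 ^ k.+1) i) => x y.
apply/matrixP => a b.
case: (@mxtens_indexP 2 (2 ^ k.+1) a) => u v.
have b0 : b = @mxtens_index 1 1 (ord0, ord0) by apply/val_inj; case: b => [[]].
have modk : ((x * 2 ^ k.+1 + y) %% 2 ^ k.+1 = y)%N by rewrite modnMDl modn_small.
have divk : ((x * 2 ^ k.+1 + y) %/ 2 ^ k.+1 = x)%N.
  by rewrite divnMDl ?expn_gt0 // divn_small // addn0.
rewrite /= -(@ket_rec_mod k k.+1) //= modk IH.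
rewrite [in LHS]b0 [LHS]tensmxE !mxE (ord1 b) !eqxx !andbT /bit divk.
have -> : odd x = x :> nat by case: x {divk modk} => [[|[|]]].
rewrite -natrM mulnb; congr (_%:R); congr nat_of_bool.
apply/andP/eqP => [[/eqP ux /eqP ->]|/(can_inj (@mxtens_indexK _ _))[-> ->] //].
by congr (mxtens_index (_, _)); apply/val_inj.
Qed.

Lemma amplitudeE (n : nat) (psi : 'cV[C]_(2 ^ n)) :
  psi = \sum_(i < 2 ^ n) amplitude i psi *: ket n i.
Proof.
apply/matrixP => a b; rewrite (ord1 b) summxE (bigD1 a) //= big1 => [|i ia].
  by rewrite ketE !mxE !eqxx mulr1 addr0.
by rewrite ketE !mxE eq_sym (negPf ia) mulr0.
Qed.

Lemma flips_exists (n : nat) (s : 'I_(2 ^ n)) : exists U, flips n s U.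
Proof.
exists (diag_mx (\row_i (if i == s then -1 else 1))); split=> [|i is'].
  rewrite ketE mul_diag_mx; apply/matrixP => a b; rewrite !mxE.
  by case: eqP; rewrite /= ?mulN1r ?mulr0 ?oppr0.
rewrite ketE mul_diag_mx; apply/matrixP => a b; rewrite !mxE.
case: (a =P i) => [->|]; rewrite /= ?mulr0 //.
by rewrite -val_eqE (negPf is') mul1r.
Qed.

Lemma flips_uniq (n : nat) (s : 'I_(2 ^ n)) (U V : 'M[C]_(2 ^ n)) :
  flips n s U -> flips n s V -> U = V.
Proof.
move=> [Us Ui] [Vs Vi]; apply/matrixP => a b.
have entry (W : 'M[C]_(2 ^ n)) : W a b = (W *m ket n b) a 0.
  by rewrite ketE -colE mxE.
rewrite !entry; case: (b =P s) => [->|/eqP bs]; first by rewrite Us Vs.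
by rewrite Ui ?Vi.
Qed.

End Qubits.

Arguments ket R n i : clear implicits.
Arguments flips {R} n s U.
Arguments Hn R n : clear implicits.

(* Main.v *)
(* With A = R_Y^(n)(w), the B(w)-conjugate of the Grover operator of version (1)
   is the one of version (2), because H^(n) is an involution and A is unitary;
   so both versions produce the same state.  With phi = A |0> and
   a = <t|phi> = sin theta, the operator of version (2) is
   G = - (1 - 2 |phi><phi|) (1 - 2 |t><t|), hence
     <t| G = (1 - 4 a^2) <t| + 2 a <phi|   and   <phi| G = <phi| - 2 a <t|.
   The pair (<t|G^j|phi>, <phi|G^j|phi>) = (sin ((2j+1) theta), cos (2j theta))
   solves this recurrence; using <phi| rather than the component orthogonal to
   |t> avoids a division by cos theta, which may vanish. *)
Require Import Defs.
From mathcomp Require Import all_boot all_order all_algebra.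
From mathcomp Require Import all_classical all_reals all_analysis.
From mathcomp Require Import ring.

Set Implicit Arguments.
Unset Strict Implicit.
Unset Printing Implicit Defensive.

Import Order.TTheory GRing.Theory Num.Theory.
Local Open Scope ring_scope.
Local Open Scope complex_scope.

(** Each tensor factor on the left carries the most significant remaining bit, so peeling it off
    splits the last factor from the product. *)
Lemma ntensmxE (K : comPzRingType) (M : 'M[K]_2) n (a b : 'I_(2 ^ n)) :
  ntensmx M n a b = \prod_(m < n) M (inord (bit a m)) (inord (bit b m)).
Proof.
case: n a b => [|n] a b.
  by rewrite big_ord0 ntensmx0 mxE (ord1 (a : 'I_1)) (ord1 (b : 'I_1)) eqxx.
rewrite /ntensmx; elim: n a b => [|n IH] a b.
  rewrite big_ord1 /=; congr (M _ _); apply/val_inj;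
  by rewrite /= inordK ?ltnS ?leq_b1 ?bit_lt2.
case: (@mxtens_indexP 2 (2 ^ n.+1) a) => u x.
case: (@mxtens_indexP 2 (2 ^ n.+1) b) => v y.
have high (r : 'I_2) (z : 'I_(2 ^ n.+1)) :
    inord (bit (mxtens_index (r, z)) (ord_max : 'I_n.+2)) = r.
  apply/val_inj; rewrite /= /bit divnMDl ?expn_gt0 // divn_small // addn0.
  by rewrite inordK ?ltnS ?leq_b1 //; case: r => [[|[|]]].
have low (r : 'I_2) (z : 'I_(2 ^ n.+1)) (m : 'I_n.+1) :
    bit (mxtens_index (r, z)) (widen_ord (leqnSn n.+1) m) = bit z m.
  by rewrite -[LHS](bit_mod _ (ltn_ord m)) /= modnMDl modn_small.
rewrite [LHS]tensmxE IH [RHS]big_ord_recr [LHS]mulrC.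
congr (_ * _); last congr (M _ _).
- apply: eq_bigr => m _.
  by congr (M (inord (nat_of_bool _)) (inord (nat_of_bool _))); apply/esym/low.
- exact/esym/high.
- exact/esym/high.
Qed.

Lemma ntensmx_mul (K : comPzRingType) p q r (A : 'M[K]_(p, q))
    (B : 'M[K]_(q, r)) n :
  ntensmx (A *m B) n = ntensmx A n *m ntensmx B n.
Proof.
case: n => [|n]; first by rewrite !ntensmx0 mulmx1.
rewrite /ntensmx; elim: n => [//|n IH] /=.
by rewrite IH tensmx_mul.
Qed.

Lemma tensmx_1mx (K : pzRingType) p q :
  tensmx (1%:M : 'M[K]_p) (1%:M : 'M[K]_q) = 1%:M.
Proof.
apply/matrixP => i j.
case: (mxtens_indexP i) => a b; case: (mxtens_indexP j) => c d.
rewrite tensmxE !mxE -natrM mulnb (can_eq (@mxtens_indexK _ _)).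
by rewrite xpair_eqE.
Qed.

Lemma ntensmx_1mx (K : pzRingType) p n : ntensmx (1%:M : 'M[K]_p) n = 1%:M.
Proof.
case: n => [|n] //; rewrite /ntensmx; elim: n => [//|n IH] /=.
by rewrite IH tensmx_1mx.
Qed.

Lemma trmx_ntensmx (K : pzRingType) p q (A : 'M[K]_(p, q)) n :
  (ntensmx A n)^T = ntensmx A^T n.
Proof.
case: n => [|n]; first by rewrite !ntensmx0 trmx1.
rewrite /ntensmx; elim: n => [//|n IH] /=.
by rewrite trmx_tens IH.
Qed.

Lemma map_ntensmx (K L : pzRingType) (f : {rmorphism K -> L}) p q
    (A : 'M[K]_(p, q)) n :
  map_mx f (ntensmx A n) = ntensmx (map_mx f A) n.
Proof.
case: n => [|n]; first by rewrite !ntensmx0 map_mx1.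
rewrite /ntensmx; elim: n => [//|n IH] /=.
by rewrite map_mxT IH.
Qed.

Section Gates.
Variable R : realType.
Local Notation C := R[i].

Lemma adjoint_mul p q r (A : 'M[C]_(p, q)) (B : 'M[C]_(q, r)) :
  adjoint (A *m B) = adjoint B *m adjoint A.
Proof. by rewrite /adjoint trmx_mul map_mxM. Qed.

Lemma adjoint_ntensmx p q (A : 'M[C]_(p, q)) n :
  adjoint (ntensmx A n) = ntensmx (adjoint A) n.
Proof. by rewrite /adjoint trmx_ntensmx map_ntensmx. Qed.

Lemma prodr_if_bool (K : comPzRingType) (x y : K) (b : nat -> bool) n :
  \prod_(m < n) (if b m then x else y)
  = x ^+ (\sum_(m < n) b m)%N * y ^+ (n - \sum_(m < n) b m).
Proof.
elim: n => [|n IH]; first by rewrite !big_ord0 mulr1.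
(* Keeps the truncated subtraction honest: a false bit raises the exponent of [y] by exactly one. *)
have bn : (\sum_(m < n) b m <= n)%N.
  rewrite -[leqRHS]card_ord -sum1_card leq_sum // => m _; exact: leq_b1.
rewrite !big_ord_recr /= IH; case: (b n).
  by rewrite addn1 subSS exprS; ring.
by rewrite addn0 subSn // exprS; ring.
Qed.

Lemma mx2P (A B : 'M[C]_2) :
  A 0 0 = B 0 0 -> A 0 1 = B 0 1 -> A 1 0 = B 1 0 -> A 1 1 = B 1 1 -> A = B.
Proof.
move=> e00 e01 e10 e11; apply/matrixP => i j.
have I2 (r : 'I_2) : r = 0 \/ r = 1.
  by case: r => [[|[|//]] ?]; [left|right]; apply/val_inj.
by case: (I2 i) => ->; case: (I2 j) => ->.
Qed.

Lemma tr_RY (w : R) : (RY w)^T = RY (- w).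
Proof.
by apply: mx2P; rewrite !mxE /= mulNr ?sinN ?cosN ?opprK.
Qed.

Lemma adjoint_RY (w : R) : adjoint (RY w) = RY (- w).
Proof.
by apply: mx2P; rewrite adjointE !mxE /= mulNr ?sinN ?cosN ?opprK oppr0.
Qed.

Lemma RYNK (w : R) : RY (- w) *m RY w = 1%:M.
Proof.
have cs := cos2Dsin2 (w / 2).
apply: mx2P; rewrite !mxE !big_ord_recl big_ord0 /= !mxE /= mulNr ?sinN ?cosN;
  rewrite ?opprK addr0 -!rmorphM -rmorphD /=.
- by rewrite -!expr2 cs.
- by congr (_%:C); ring.
- by congr (_%:C); ring.
- by rewrite mulrNN -!expr2 addrC cs.
Qed.

Lemma adjoint_hadamard : adjoint (hadamard R) = hadamard R.
Proof.
by apply: mx2P; rewrite adjointE !mxE; apply/eqP; rewrite eq_complex /=;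
  apply/andP; split; apply/eqP; ring.
Qed.

Lemma hadamardK : hadamard R *m hadamard R = 1%:M.
Proof.
(* The only fact about the normalisation that the entries need; the factor is then abstracted to
   [r]. *)
have hh : (Num.sqrt (2 : R))^-1 ^+ 2 * 2 = 1.
  by rewrite exprVn sqr_sqrtr ?ler0n // mulVf // pnatr_eq0.
rewrite /hadamard; move: (_^-1) hh => r hh.
by apply: mx2P; rewrite !mxE !big_ord_recl big_ord0 /= !mxE /=;
  apply/eqP; rewrite eq_complex /=; apply/andP; split; apply/eqP; ring: hh.
Qed.

Lemma RYnNK n (w : R) : RYn n (- w) *m RYn n w = 1%:M.
Proof. by rewrite -ntensmx_mul RYNK ntensmx_1mx. Qed.

Lemma RYnKN n (w : R) : RYn n w *m RYn n (- w) = 1%:M.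
Proof. by rewrite -{1}(opprK w) RYnNK. Qed.

Lemma HnK n : Hn R n *m Hn R n = 1%:M.
Proof. by rewrite -ntensmx_mul hadamardK ntensmx_1mx. Qed.

(** All bits of 0 vanish, so only the first column (cos, sin) of [RY w] enters: each 1 of [t]
    contributes a sine and each 0 a cosine. *)
Lemma amplitude_RYn n (w : R) (t : 'I_(2 ^ n)) :
  amplitude t (RYn n w *m ket R n 0) =
  (sin (w / 2) ^+ hamming_weight n t
   * cos (w / 2) ^+ (n - hamming_weight n t))%:C.
Proof.
have n0 : (0 < 2 ^ n)%N by rewrite expn_gt0.
rewrite (ketE R (Ordinal n0)) -colE /amplitude mxE ntensmxE.
transitivity (\prod_(m < n) (if bit t m then sin (w / 2) else cos (w / 2))%:C).
  apply: eq_bigr => m _; rewrite !mxE /bit div0n /=.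
  have -> : inord 0 == 0 :> 'I_2 by apply/eqP/val_inj; rewrite /= inordK.
  by case: odd; rewrite -val_eqE /= inordK.
by rewrite -rmorph_prod prodr_if_bool.
Qed.

End Gates.

(** The four pairings of the rows [f], [psi] with the columns [e], [phi] determine the action of [G]
    on the span of [f] and [psi]. *)
Lemma grover_step (K : comPzRingType) n (a : K) (e phi : 'cV[K]_n)
    (f psi : 'rV[K]_n)
    (G := - ((1%:M - 2 *: (phi *m psi)) *m (1%:M - 2 *: (e *m f)))) :
  f *m e = 1%:M -> psi *m phi = 1%:M -> f *m phi = a%:M -> psi *m e = a%:M ->
  f *m G = (1 - 4 * a ^+ 2) *: f + (2 * a) *: psi /\
  psi *m G = psi - (2 * a) *: f.
Proof.
move=> fe pp fp pe.
have ref1 p (r : 'rV[K]_n) (u : 'cV[K]_n) (q : 'rV[K]_n) :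
    r *m u = p%:M -> r *m (1%:M - 2 *: (u *m q)) = r - (2 * p) *: q.
  move=> ru; rewrite mulmxBr mulmx1 -scalemxAr mulmxA ru.
  by rewrite mul_scalar_mx scalerA.
(* The first reflection leaves [r - (2 * p) *: psi], whose pairing with [e] is [q - 2 * p * a]. *)
have ref2 p q (r : 'rV[K]_n) : r *m phi = p%:M -> r *m e = q%:M ->
    r *m G = - (r - (2 * p) *: psi - (2 * (q - 2 * p * a)) *: f).
  move=> rphi re; rewrite mulmxN mulmxA (ref1 _ _ _ _ rphi).
  rewrite (ref1 (q - 2 * p * a)) //.
  by rewrite mulmxBl -scalemxAl re pe scale_scalar_mx -rmorphB.
split; [rewrite (ref2 _ _ _ fp fe)|rewrite (ref2 _ _ _ pp pe)];
by apply/matrixP => i j; rewrite !mxE; ring.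
Qed.

Lemma grover_rotation (R : realType) n (x : R) (e phi : 'cV[R[i]]_n)
    (f psi : 'rV[R[i]]_n) (a := (sin x)%:C)
    (G := - ((1%:M - 2 *: (phi *m psi)) *m (1%:M - 2 *: (e *m f)))) j :
  f *m e = 1%:M -> psi *m phi = 1%:M -> f *m phi = a%:M -> psi *m e = a%:M ->
  f *m (G ^+ j *m phi) = (sin ((2 * j + 1)%:R * x))%:C%:M /\
  psi *m (G ^+ j *m phi) = (cos ((2 * j)%:R * x))%:C%:M.
Proof.
move=> fe pp fp pe; have [fG pG] := grover_step fe pp fp pe.
elim: j => [|j [IHf IHp]].
  by rewrite expr0 mul1mx muln0 add0n mul1r mul0r cos0 fp pp.
have -> : (2 * j.+1)%:R * x = (2 * j)%:R * x + x + x.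
  by rewrite mulnS natrD; ring.
have -> : (2 * j.+1 + 1)%:R * x = (2 * j)%:R * x + x + x + x.
  by rewrite mulnS !natrD; ring.
have uE : (2 * j + 1)%:R * x = (2 * j)%:R * x + x by rewrite natrD mulrDl mul1r.
(* With [u] for the even multiple of [x], the recurrence becomes two trigonometric identities in
   free [u] and [x]. *)
rewrite uE in IHf; move: ((2 * j)%:R * x) IHf IHp => u IHf IHp.
have cs : cos x ^+ 2 = 1 - sin x ^+ 2 by rewrite -(cos2Dsin2 x) addrK.
have -> : G ^+ j.+1 = G *m G ^+ j by rewrite exprS.
rewrite -(mulmxA G) 2!(mulmxA _ G) fG pG mulmxDl mulmxBl -!scalemxAl IHf IHp.
rewrite !scale_scalar_mx /a.
have sinE : sin (u + x + x + x)
    = (1 - 4 * sin x ^+ 2) * sin (u + x) + 2 * sin x * cos u.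
  by rewrite !(sinD, cosD); ring: cs.
have cosE : cos (u + x + x) = cos u - 2 * sin x * sin (u + x).
  by rewrite !(sinD, cosD); ring: cs.
rewrite sinE cosE; split.
  rewrite -raddfD /=; congr (_%:M).
  by rewrite rmorphD !rmorphM rmorphB rmorphM rmorphXn rmorph1 !rmorph_nat.
rewrite -raddfB /=; congr (_%:M).
by rewrite rmorphB !rmorphM !rmorph_nat.
Qed.

(** By [flips_uniq] it suffices that the rank-one reflection acts correctly on basis states. *)
Lemma flipsE (R : realType) n (s : 'I_(2 ^ n)) (U : 'M[R[i]]_(2 ^ n)) :
  flips n s U ->
  U = 1%:M - 2 *: (delta_mx s (0 : 'I_1) *m delta_mx (0 : 'I_1) s).
Proof.
move=> Us; apply: (flips_uniq Us); split => [|i is'].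
  rewrite ketE mulmxBl mul1mx -scalemxAl -mulmxA !mul_delta_mx.
  by rewrite scaler_nat mulr2n opprD addNKr.
rewrite ketE mulmxBl mul1mx -scalemxAl -mulmxA mul_delta_mx_0.
  by rewrite mulmx0 scaler0 subr0.
by rewrite eq_sym.
Qed.

Lemma B_uniform_mul_G_uniformX (R : realType) n (D O : 'M[R[i]]_(2 ^ n))
    (w : R) j :
  B_uniform n w *m G_uniform D O w ^+ j =
  G_binomial D O w ^+ j *m B_uniform n w.
Proof.
elim: j => [|j IH]; first by rewrite !expr0 mulmx1 mul1mx.
rewrite !exprSr -![_ * _]/(_ *m _) mulmxA IH -!mulmxA; congr (_ *m _).
rewrite /G_uniform /G_binomial mulmxN mulNmx /B_uniform adjoint_mul /Hn.
rewrite !adjoint_ntensmx adjoint_hadamard adjoint_RY -/(RYn n (- w)).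
rewrite -/(Hn R n) -!mulmxA mulmxN; congr (- (_ *m _)).
(* Two adjacent pairs of [Hn] cancel: one where [B_uniform] meets [G_uniform], one where [Hn] meets
   the adjoint of [B_uniform]. *)
by rewrite !(mulmxA (Hn R n) (Hn R n)) HnK !mul1mx.
Qed.

Theorem theorem2 (R : realType) (n : nat) (n_ge1 : (1 <= n)%N)
    (t : 'I_(2 ^ n)) (k : nat) (k_def : k = hamming_weight n t)
    (D O : 'M[R[i]]_(2 ^ n)) (D_def : flips n 0 D) (O_def : flips n t O)
    (w : R) (w_range : 0 <= w <= pi) (j : nat) :
  amplitude t (B_uniform n w *m G_uniform D O w ^+ j *m Hn R n *m ket R n 0)
    = (sin ((2 * j + 1)%:R * theta n k w))%:C
  /\
  amplitude t (G_binomial D O w ^+ j *m RYn n w *m ket R n 0)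
    = (sin ((2 * j + 1)%:R * theta n k w))%:C.
Proof.
(* Once [B_uniform] has passed the Grover iterations, its [Hn] cancels the one preparing the uniform
   superposition, leaving the state of the second version. *)
rewrite B_uniform_mul_G_uniformX /B_uniform -(mulmxA _ _ (Hn R n))
  -(mulmxA _ (Hn R n)) HnK.
rewrite mulmx1.
suff H : amplitude t (G_binomial D O w ^+ j *m RYn n w *m ket R n 0)
    = (sin ((2 * j + 1)%:R * theta n k w))%:C by split.
have n0 : (0 < 2 ^ n)%N by rewrite expn_gt0.
pose s0 := Ordinal n0.
pose phi := RYn n w *m ket R n 0.
(* The dual row of [phi]; [RY] has real entries, so transposition serves as the adjoint. *)
pose psi := (ket R n 0)^T *m RYn n (- w).
pose e : 'cV[R[i]]_(2 ^ n) := delta_mx t 0.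
have trRYn : (RYn n w)^T = RYn n (- w) by rewrite trmx_ntensmx tr_RY.
have psiE : psi = phi^T by rewrite trmx_mul trRYn.
have ampE v : amplitude t v = (e^T *m v) 0 0 by rewrite trmx_delta -rowE mxE.
have sin_theta : sin (theta n k w)
    = sin (w / 2) ^+ k * cos (w / 2) ^+ (n - k).
  (* The argument of [asin] is a product of powers of numbers in [-1, 1], hence lies in its
     domain. *)
  rewrite asinK // in_itv /= -ler_norml normrM !normrX.
  rewrite mulr_ile1 ?exprn_ge0 ?exprn_ile1 // ler_norml.
    by rewrite sin_geN1 sin_le1.
  by rewrite cos_geN1 cos_le1.
have fp : e^T *m phi = (sin (theta n k w))%:C%:M.
  by rewrite [LHS]mx11_scalar -ampE amplitude_RYn -k_def sin_theta.
have pp : psi *m phi = 1%:M.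
  rewrite /psi /phi mulmxA -(mulmxA _ (RYn n (- w))) RYnNK mulmx1.
  by rewrite (ketE R s0) trmx_delta mul_delta_mx [LHS]mx11_scalar mxE.
have fe : e^T *m e = 1%:M.
  by rewrite trmx_delta mul_delta_mx [LHS]mx11_scalar mxE.
have pe : psi *m e = (sin (theta n k w))%:C%:M.
  by rewrite psiE -[e]trmxK -trmx_mul fp tr_scalar_mx.
have GE : G_binomial D O w
    = - ((1%:M - 2 *: (phi *m psi)) *m (1%:M - 2 *: (e *m e^T))).
  rewrite /G_binomial (flipsE O_def) trmx_delta; congr (- (_ *m _)).
  (* Conjugating the reflection in the zero state by [RYn n w] gives the reflection in [phi]. *)
  rewrite (@flipsE _ _ s0 _ D_def) mulmxBr mulmx1 mulmxBl RYnKN.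
  by rewrite -scalemxAr -scalemxAl /phi /psi (ketE R s0) trmx_delta !mulmxA.
have [H _] := grover_rotation j fe pp fp pe.
by rewrite ampE GE -mulmxA H mxE.
Qed.
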